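(* Let $(Z,d_Z)$ be a bounded complete separable metric space, $p,r\in[1,\infty]$, and let $(X,\omega_X,\mu_X)$, $(Y,\omega_Y,\mu_Y)$ be $Z$-networks. Fix $Q=(q_1,\dots,q_n)\in Z^n$ and define $\mathbb{R}^n$-networks $X_Q=(X,\omega_{X_Q},\mu_X)$ and $Y_Q=(Y,\omega_{Y_Q},\mu_Y)$ by $$\omega_{X_Q}(x,x')=\big(d_Z(\omega_X(x,x'),q_i)\big)_{i=1}^n,\qquad \omega_{Y_Q}(y,y')=\big(d_Z(\omega_Y(y,y'),q_i)\big)_{i=1}^n .$$ Then, with $\mathbb{R}^n$ equipped with the $\ell^r$ distance, $$n^{-1/r}\,\mathrm{GW}_p^{\mathbb{R}^n}(X_Q,Y_Q)\ \le\ \mathrm{GW}_p^Z(X,Y)\ \le\ \mathrm{GW}_p^{\mathbb{R}^n}(X_Q,Y_Q)+\mathrm{H}(Z,Q),$$ where $\mathrm{H}(Z,Q)$ is the Hausdorff distance between $Z$ and $\{q_1,\dots,q_n\}$ in $Z$, and $n^{-1/\infty}=1$.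
   Context: For a complete separable metric space $(S,d_S)$, an $S$-network (more precisely an $(S,p)$-network) is a triple $(X,\omega_X,\mu_X)$ where $X$ is a Polish space, $\mu_X$ is a Borel probability measure on $X$, and $\omega_X:X\times X\to S$ is measurable with $\|d_S(\omega_X(\cdot,\cdot),s_0)\|_{L^p(\mu_X\otimes\mu_X)}<\infty$ for some (equivalently every) $s_0\in S$. With $\mathcal{C}(\mu_X,\mu_Y)$ the set of couplings of $\mu_X,\mu_Y$, $$\mathrm{GW}_p^S(X,Y)=\tfrac12\inf_{\pi\in\mathcal{C}(\mu_X,\mu_Y)}\big\|(x,y,x',y')\mapsto d_S(\omega_X(x,x'),\omega_Y(y,y'))\big\|_{L^p(\pi\otimes\pi)}$$ (essential supremum if $p=\infty$). *)

(* Defs.v *)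
From HB Require Import structures.
From mathcomp Require Import all_boot all_order all_algebra.
From mathcomp Require Import all_classical all_reals all_analysis.
From mathcomp Require Import measurable_realfun ess_sup_inf.

Set Implicit Arguments.
Unset Strict Implicit.
Unset Printing Implicit Defensive.
Import Order.TTheory GRing.Theory Num.Theory.
Import numFieldNormedType.Exports.
Local Open Scope classical_set_scope.
Local Open Scope ring_scope.

Definition separable (T : topologicalType) : Prop :=
  exists2 D : set T, countable D & dense D.

Section distances.
Context {R : realType} {T : Type}.
Implicit Type d : T -> T -> R.

Definition is_distance d : Prop :=
  [/\ forall x, d x x = 0, forall x y, d x y = 0 -> x = y,
      forall x y, d x y = d y x & forall x y z, d x z <= d x y + d y z].

Definition cauchy_complete d : Prop :=
  forall u : nat -> T,
    (forall e, 0 < e ->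
      exists N, forall i j, (N <= i)%N -> (N <= j)%N -> d (u i) (u j) < e) ->
    exists l, d (u i) l @[i --> \oo] --> (0 : R).

Definition bounded_distance d : Prop := exists M, forall x y, d x y <= M.
End distances.

Definition metrizes {R : realType} (T : topologicalType) (d : T -> T -> R) :
    Prop :=
  forall (x : T) (A : set T),
    nbhs x A <-> exists2 e, 0 < e & [set y | d x y < e] `<=` A.

Definition polish (R : realType) (T : topologicalType) : Prop :=
  separable T /\
  exists d : T -> T -> R, [/\ is_distance d, metrizes d & cauchy_complete d].

Definition borel (T : ptopologicalType) : measurableType (@open T).-sigma :=
  g_sigma_algebraType (@open T).

(* [omega_measurable] spells out measurability for the Borel sets of [S]: a
   [measurableType] on [S] would require a distinguished point. On [X * X] the
   product sigma-algebra is the Borel one, since [X] is second countable. *)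
Record network (R : realType) (S : metricType R) (p : \bar R) := Network {
  carrier :> ptopologicalType ;
  carrier_polish : polish R carrier ;
  mu : probability (borel carrier) R ;
  omega : carrier -> carrier -> S ;
  omega_measurable : forall B : set S, <<s @open S >> B ->
    measurable ([set z | B (omega z.1 z.2)] :
      set (borel carrier * borel carrier)) ;
  omega_finite : exists s0 : S,
    (Lnorm (mu \x mu) p (fun z => (mdist (omega z.1 z.2) s0)%:E) < +oo)%E
}.
Arguments omega {R S p} n _ _.

Definition coupling {R : realType} d1 d2 (T1 : measurableType d1)
    (T2 : measurableType d2) (mu1 : probability T1 R) (mu2 : probability T2 R) :
    set (probability (T1 * T2)%type R) :=
  [set pi | (forall A, measurable A -> pushforward pi fst A = mu1 A) /\
            (forall B, measurable B -> pushforward pi snd B = mu2 B)].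

Definition GW {R : realType} {S : metricType R} {p : \bar R}
    (X Y : network S p) : \bar R :=
  ((2^-1)%:E * ereal_inf
    [set Lnorm (pi \x pi) p (fun z =>
       (mdist (omega X z.1.1 z.2.1) (omega Y z.1.2 z.2.2))%:E) |
     pi in coupling (mu X) (mu Y)])%E.

(* Extended-real valued, so that neither set has to be bounded. *)
Definition hausdorff_distance {R : realType} {S : metricType R} (A B : set S) :
    \bar R :=
  maxe (ereal_sup [set ereal_inf [set (mdist a b)%:E | b in B] | a in A])
       (ereal_sup [set ereal_inf [set (mdist a b)%:E | a in A] | b in B]).

(* R^n with the l^r distance; it carries the metric topology of that distance
   and does not inherit the sup-norm structures of ['rV[R]_n]. The proof [r1]
   is a parameter because the triangle inequality needs it. *)
Definition ell (R : realType) (n : nat) (r : \bar R) (r1 : (1 <= r)%E) : Type :=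
  'rV[R]_n.
HB.instance Definition _ R n r r1 := Choice.copy (@ell R n r r1) 'rV[R]_n.

(* For [1 <= r] the last branch is only reached at [r = +oo]. *)
Definition ell_norm {R : realType} {n : nat} (r : \bar R) (x : 'rV[R]_n) : R :=
  match r with
  | s%:E => (\sum_i `|x ord0 i| `^ s) `^ s^-1
  | _ => \big[Num.max/0]_i `|x ord0 i|
  end.

Section ell_metric.
Context {R : realType} {n : nat} {r : \bar R} (r1 : (1 <= r)%E).
Implicit Types x y : 'rV[R]_n.

Lemma ell_norm_ge0 x : 0 <= ell_norm r x.
Proof.
by rewrite /ell_norm; case: r => [s||]; rewrite ?powR_ge0 ?bigmax_ge_id.
Qed.

Lemma ell_normN x : ell_norm r (- x) = ell_norm r x.
Proof.
rewrite /ell_norm; case: r => [s||]; [congr (_ `^ _)| |]; apply: eq_bigr => i _;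
  by rewrite mxE normrN.
Qed.

Lemma ell_norm_ge x i : `|x ord0 i| <= ell_norm r x.
Proof.
rewrite /ell_norm; case: r r1 => [s||//]; last by move=> _; exact: le_bigmax.
rewrite lee_fin => s1; have s0 : 0 < s by rewrite (lt_le_trans _ s1).
rewrite -[leLHS](@powRr1 R _)// -(@divff _ s) ?gt_eqF// powRrM.
have sum_ge0 (P : pred 'I_n) : 0 <= \sum_(j | P j) `|x ord0 j| `^ s.
  by apply: sumr_ge0 => j _; exact: powR_ge0.
apply: ge0_ler_powR; [by rewrite invr_ge0 ltW|by rewrite nnegrE powR_ge0|
  by rewrite nnegrE sum_ge0|].
by rewrite (bigD1 i)//= lerDl sum_ge0.
Qed.

Lemma ell_norm0 : ell_norm r (0 : 'rV[R]_n) = 0.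
Proof.
rewrite /ell_norm; case: r r1 => [s||//].
  rewrite lee_fin => s1.
  have s0 : s != 0 by rewrite gt_eqF// (lt_le_trans _ s1).
  rewrite big1 ?powR0 ?invr_eq0// => i _.
  by rewrite mxE normr0 powR0.
by move=> _; apply: bigmax_eq_id => i _; rewrite mxE normr0.
Qed.

Lemma ell_norm_eq0 x : ell_norm r x = 0 -> x = 0.
Proof.
move=> x0; apply/rowP => i; rewrite mxE; apply/eqP.
by rewrite -normr_le0 -x0 ell_norm_ge.
Qed.

Let ext x (k : nat) : R := if insub k is Some i then x ord0 i else 0.

Let ell_norm_Lnorm s x : 0 < s ->
  (ell_norm s%:E x)%:E = Lnorm counting s%:E (EFin \o ext x).
Proof.
move=> s0; rewrite Lnorm_counting//.
rewrite (nneseries_split 0 n)//; last by move=> k _; exact: poweR_ge0.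
rewrite [X in (_ + X)%E]eseries0 ?adde0; last first.
  move=> k; rewrite add0n => nk _ /=; rewrite /ext insubN -?leqNgt//.
  by rewrite normr0 powR0 ?gt_eqF.
rewrite add0n big_mkord /=.
rewrite (eq_bigr (fun i : 'I_n => (`|x ord0 i| `^ s)%:E)) ?sumEFin ?poweR_EFin//.
move=> i _; have iE : insub (i : nat) = Some i by exact: valK.
by rewrite /ext iE.
Qed.

Lemma ell_normD x y : ell_norm r (x + y) <= ell_norm r x + ell_norm r y.
Proof.
case: r r1 => [s||//]; last first.
  move=> _; apply: bigmax_le => [|i _]; first by rewrite addr_ge0 ?bigmax_ge_id.
  by rewrite mxE (le_trans (ler_normD _ _))// lerD//; exact: le_bigmax.
rewrite lee_fin => s1; have s0 : 0 < s by rewrite (lt_le_trans _ s1).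
rewrite -lee_fin EFinD !ell_norm_Lnorm//.
have -> : ext (x + y) = (ext x \+ ext y)%R.
  by apply/funext => k; rewrite /ext /=; case: insub => [i|]; rewrite ?mxE ?addr0.
exact: minkowski_EFin.
Qed.

Definition ell_dist x y : R := ell_norm r (x - y).

Let ell_distxx x : ell_dist x x = 0.
Proof. by rewrite /ell_dist subrr ell_norm0. Qed.

Let ell_dist_eq0 x y : ell_dist x y = 0 -> x = y.
Proof. by move/ell_norm_eq0/eqP; rewrite subr_eq0 => /eqP. Qed.

Let ell_dist_sym x y : ell_dist x y = ell_dist y x.
Proof. by rewrite /ell_dist -ell_normN opprB. Qed.

Let ell_dist_triangle y x z : ell_dist x z <= ell_dist x y + ell_dist y z.
Proof. by rewrite /ell_dist (le_trans _ (ell_normD _ _))// addrA subrK. Qed.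

HB.instance Definition _ := @isMetric.Build R (ell n r1) ell_dist
  ell_distxx ell_dist_eq0 ell_dist_sym ell_dist_triangle.
End ell_metric.

Lemma open_mball {R : realType} {S : metricType R} (s0 : S) (e : R) :
  open [set s : S | mdist s s0 < e].
Proof.
rewrite openE => s /= se; apply/nbhs_ballP; exists (e - mdist s s0) => /=.
  by rewrite subr_gt0.
move=> t; rewrite ballEmdist/= ltrBrDr (metric_sym s t) => ts.
by rewrite (le_lt_trans (metric_triangle _ s _)).
Qed.

Lemma borel_preimage {T S : topologicalType} (f : T -> S) (B : set S) :
  continuous f -> <<s @open S >> B -> <<s @open T >> (f @^-1` B).
Proof.
move=> cf; have : <<s @open S >> `<=` image_set_system setT f <<s @open T >>.
  apply: smallest_sub; first exact/sigma_algebra_image/smallest_sigma_algebra.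
  move=> U oU; rewrite /image_set_system/= setTI; apply: sub_sigma_algebra.
  by apply: open_comp => // x _; exact: cf.
by move=> /[apply]; rewrite /image_set_system/= setTI.
Qed.

Lemma lipschitz_continuous {R : realType} {S S' : metricType R} (f : S -> S')
    (C : R) : 0 <= C -> (forall w w', mdist (f w) (f w') <= C * mdist w w') ->
  continuous f.
Proof.
move=> C0 fC w A /nbhs_ballP[e /= e0 eA]; apply/nbhs_ballP.
exists (e / (C + 1)) => /=; first by rewrite divr_gt0// ltr_wpDl.
move=> w'; rewrite ballEmdist/= => ww'; apply: eA; rewrite ballEmdist/=.
rewrite (le_lt_trans (fC _ _))// (@le_lt_trans _ _ ((C + 1) * mdist w w'))//.
  by rewrite ler_wpM2r ?mdist_ge0 ?lerDl.
by rewrite mulrC -ltr_pdivlMr// ltr_wpDl.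
Qed.

Lemma Lnorm_dominated_lty d (T : measurableType d) (R : realType)
    (m : {measure set T -> \bar R}) (p : \bar R) (f g : T -> R) (C : R) :
  (1 <= p)%E -> 0 <= C ->
  measurable_fun setT f -> measurable_fun setT g ->
  (forall x, 0 <= f x) -> (forall x, f x <= C * g x) ->
  (Lnorm m p (EFin \o g) < +oo)%E -> (Lnorm m p (EFin \o f) < +oo)%E.
Proof.
move=> p1 C0 mf mg f0 fg; rewrite unlock /Lnorm.
have fg' x : `|f x| <= C * `|g x|.
  by rewrite ger0_norm// (le_trans (fg x))// ler_wpM2l// ler_norm.
case: p p1 => [s||//].
- rewrite lee_fin => s1; have s0 : 0 < s by rewrite (lt_le_trans _ s1).
  move=> gy; apply: poweR_lty; move: gy => /lty_poweRy.
  rewrite gt_eqF ?invr_gt0// => /(_ isT) gy.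
  have mh (h : T -> R) : measurable_fun setT h ->
      measurable_fun [set: T] (fun x => `|(EFin \o h) x| `^ s)%E.
    move=> mh; under eq_fun do rewrite poweR_EFin.
    apply/measurable_EFinP.
    apply: (@measurableT_comp _ _ _ _ _ _ (@powR R ^~ s)) => //.
    exact: measurableT_comp.
  apply: (@le_lt_trans _ _ ((C `^ s)%:E * \int[m]_x (`|g x|%:E `^ s))%E).
    rewrite -ge0_integralZl_EFin ?powR_ge0//; last 2 first.
    + by move=> x _; exact: poweR_ge0.
    + exact: mh.
    apply: ge0_le_integral => //.
    + by move=> x _; exact: poweR_ge0.
    + exact: mh.
    + by apply: measurable_funeM; exact: mh.
    move=> x _; rewrite /= -EFinM lee_fin -powRM//.
    by apply: ge0_ler_powR; rewrite ?nnegrE ?mulr_ge0// ltW.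
  by rewrite lte_mul_pinfty// ?lee_fin ?powR_ge0.
- move=> _; case: ifPn => // m0 gy.
  apply: (@le_lt_trans _ _ (C%:E * ess_sup m (abse \o (EFin \o g)))%E).
    rewrite -ess_supZl//; apply: le_ess_sup; apply: nearW => x /=.
    by rewrite lee_fin.
  by rewrite lte_mul_pinfty.
Qed.

Lemma measurable_mdist_omega {R : realType} {S : metricType R} {p : \bar R}
    (X : network S p) (f : S -> R) : (forall e, open [set s | f s < e]) ->
  measurable_fun setT (fun z : borel X * borel X => f (omega X z.1 z.2)).
Proof.
move=> fo; apply: (measurability _ (RGenInftyO.measurableE R)).
move=> _ [_ [e ->] <-]; rewrite setTI.
rewrite (_ : _ @^-1` _ = [set z | [set s | f s < e] (omega X z.1 z.2)]).
  by apply: omega_measurable; exact: sub_sigma_algebra.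
by apply/seteqP; split => z; rewrite /= in_itv.
Qed.

Section distance_network.
Context {R : realType} {Z : metricType R} {p r : \bar R}.
Variables (p1 : (1 <= p)%E) (r1 : (1 <= r)%E) (n : nat) (q : 'I_n -> Z).

Definition distances_to (w : Z) : ell n r1 := \row_i mdist w (q i).

Let C : R := if r is s%:E then n%:R `^ s^-1 else 1.

Let C0 : 0 <= C. Proof. by rewrite /C; case: r => // s; exact: powR_ge0. Qed.

Let distances_to_lipschitz w w' :
  mdist (distances_to w) (distances_to w') <= C * mdist w w'.
Proof.
have dq i : `|(distances_to w - distances_to w' : 'rV[R]_n) ord0 i| <= mdist w w'.
  rewrite !mxE ler_norml lerBlDr (metric_triangle _ w') andbT lerNl opprB.
  by rewrite lerBlDr (metric_sym w) (metric_triangle _ w).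
rewrite [leLHS]/(ell_norm r (distances_to w - distances_to w' : 'rV[R]_n)).
move: dq; set x := (_ - _ : 'rV[R]_n) => dq.
rewrite /C /ell_norm; case: r r1 => [s||//]; last first.
  by move=> _; rewrite mul1r; apply: bigmax_le => [|i _]; [exact: mdist_ge0|exact: dq].
rewrite lee_fin => s1; have s0 : 0 < s by rewrite (lt_le_trans _ s1).
have -> : n%:R `^ s^-1 * mdist w w' = (n%:R * mdist w w' `^ s) `^ s^-1.
  by rewrite powRM ?powR_ge0// -powRrM divff ?gt_eqF// powRr1 ?mdist_ge0.
have sum_le : \sum_i `|x ord0 i| `^ s <= n%:R * mdist w w' `^ s.
  rewrite mulr_natl -[X in _ *+ X]card_ord -sumr_const; apply: ler_sum => i _.
  by apply: ge0_ler_powR; [exact: ltW|rewrite nnegrE|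
    rewrite nnegrE mdist_ge0|exact: dq].
apply: ge0_ler_powR => //; first by rewrite invr_ge0 ltW.
  by rewrite nnegrE sumr_ge0// => i _; exact: powR_ge0.
by rewrite nnegrE mulr_ge0 ?powR_ge0.
Qed.

Variable X : network Z p.

Let omegaQ (x x' : X) : ell n r1 := distances_to (omega X x x').

Let omegaQ_measurable (B : set (ell n r1)) : <<s @open (ell n r1) >> B ->
  measurable ([set z | B (omegaQ z.1 z.2)] : set (borel X * borel X)).
Proof.
move=> mB; apply: (@omega_measurable _ _ _ X (distances_to @^-1` B)).
by apply: borel_preimage mB; exact: lipschitz_continuous distances_to_lipschitz.
Qed.

Let omegaQ_finite : exists s0 : ell n r1,
  (Lnorm (mu X \x mu X) p (fun z => (mdist (omegaQ z.1 z.2) s0)%:E) < +oo)%E.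
Proof.
have [s0 fin0] := omega_finite X; exists (distances_to s0).
apply: (@Lnorm_dominated_lty _ _ R (mu X \x mu X)%E p
  (fun z : borel X * borel X => mdist (omegaQ z.1 z.2) (distances_to s0))
  (fun z => mdist (omega X z.1 z.2) s0) C p1 C0) => //.
- apply: (measurable_mdist_omega (f := fun s =>
    mdist (distances_to s) (distances_to s0))) => e.
  apply: (@open_comp _ _ distances_to [set t | mdist t (distances_to s0) < e]).
    by move=> x _; exact: lipschitz_continuous distances_to_lipschitz x.
  exact: open_mball.
- apply: (measurable_mdist_omega (f := fun s => mdist s s0)) => e.
  exact: open_mball.
- by move=> z; exact: mdist_ge0.
- by move=> z; exact: distances_to_lipschitz.
Qed.

Definition distance_network : network (ell n r1) p :=
  Network (carrier_polish X) omegaQ_measurable omegaQ_finite.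
End distance_network.

Definition GW_lower_factor {R : realType} (n : nat) (r : \bar R) : R :=
  if r is s%:E then n%:R `^ (- s^-1) else 1.

(* Main.v *)
Require Import Defs.
From HB Require Import structures.
From mathcomp Require Import all_boot all_order all_algebra.
From mathcomp Require Import all_classical all_reals all_analysis.
From mathcomp Require Import measurable_realfun ess_sup_inf lra.

Import Order.TTheory GRing.Theory Num.Theory.
Import numFieldNormedType.Exports.
Local Open Scope classical_set_scope.
Local Open Scope ring_scope.

(** The networks X_Q and Y_Q carry the same spaces and measures as X and Y, so
both infima run over the same couplings pi, and the two inequalities may be
proved for the L^p norms attached to one fixed pi. Write Phi for the map
w |-> (d_Z(w, q_i))_i ([distances_to]).

- Lower bound. Each coordinate of Phi is 1-Lipschitz, and a vector whose n
  coordinates are bounded by D has l^r norm at most n^(1/r) D; hence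
  n^(-1/r) |Phi w - Phi w'|_r <= d_Z(w, w') ([mdist_distances_to_le]).

- Upper bound. If every point of Z is within h of some q_i, going from w to w'
  through the q_i that is near w gives
  d_Z(w, w') <= d_Z(w, q_i) + d_Z(q_i, w')
             <= 2 d_Z(w, q_i) + |d_Z(w', q_i) - d_Z(w, q_i)|
             <= 2 h + |Phi w - Phi w'|_r
  ([mdist_le_distances_to]). Any h above the Hausdorff distance is admissible,
  and the factor 1/2 in the definition of GW turns 2 h into h.

Both pointwise inequalities are integrated against pi (x) pi: the norm is
monotone, homogeneous, satisfies Minkowski's inequality, and sends a constant
to itself because pi (x) pi is a probability measure. *)

(** The integral of a nonnegative function is a supremum over the simple
functions below it, so enlarging the function enlarges that set of simple
functions, measurable or not. Arbitrary [f] and [g] are allowed so that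
d_Z(omega_X, omega_Y) need not be shown jointly measurable. *)
Lemma ge0_le_Lnorm d (T : measurableType d) (R : realType)
    (m : {measure set T -> \bar R}) (p : \bar R) (f g : T -> R) :
  (1 <= p)%E -> (forall x, 0 <= f x <= g x) ->
  (Lnorm m p (EFin \o f) <= Lnorm m p (EFin \o g))%E.
Proof.
move=> p1 fg; have f0 x : 0 <= f x by have /andP[] := fg x.
have g0 x : 0 <= g x by have /andP[/le_trans + ?] := fg x; apply.
rewrite unlock /Lnorm; case: p p1 => [s||//].
  rewrite lee_fin => s1; have s0 : 0 < s by rewrite (lt_le_trans _ s1).
  apply: gt0_ler_poweR; first by rewrite invr_ge0 ltW.
  - by rewrite in_itv/= leey andbT integral_ge0// => x _; exact: poweR_ge0.
  - by rewrite in_itv/= leey andbT integral_ge0// => x _; exact: poweR_ge0.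
  rewrite !ge0_integralTE; [|by move=> x; exact: poweR_ge0..].
  apply: ereal_sup_le => _ [h hf <-]; exists h => // x.
  apply: (le_trans (hf x)); rewrite /= lee_fin !ger0_norm//.
  have /andP[_ fgx] := fg x.
  by apply: ge0_ler_powR; rewrite ?nnegrE// ltW.
move=> _; case: ifPn => // m0; apply: le_ess_sup; apply: nearW => x /=.
by rewrite lee_fin !ger0_norm//; have /andP[] := fg x.
Qed.

(** Unlike homogeneity on the space L^p, this also covers an infinite norm. *)
Lemma ge0_LnormZ d (T : measurableType d) (R : realType)
    (m : {measure set T -> \bar R}) (p : \bar R) (c : R) (f : T -> R) :
  (1 <= p)%E -> 0 <= c -> measurable_fun setT f ->
  Lnorm m p (fun x => (c * f x)%:E) = (c%:E * Lnorm m p (EFin \o f))%E.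
Proof.
move=> p1 c0 mf; rewrite unlock /Lnorm; case: p p1 => [s||//].
  rewrite lee_fin => s1; have s0 : 0 < s by rewrite (lt_le_trans _ s1).
  under eq_integral => x _ do
    rewrite /= normrM powRM// (ger0_norm c0) EFinM.
  rewrite ge0_integralZl_EFin//; last 2 first.
  - apply/measurable_EFinP.
    apply: (@measurableT_comp _ _ _ _ _ _ (@powR R ^~ s)) => //.
    exact: measurableT_comp.
  - exact: powR_ge0.
  rewrite poweRM ?lee_fin ?powR_ge0//; last first.
    by apply: integral_ge0 => x _; rewrite lee_fin powR_ge0.
  by rewrite -[in LHS]poweR_EFin -poweRrM divff ?gt_eqF// poweRe1 ?lee_fin.
move=> _; case: ifPn => m0; last by rewrite mule0.
rewrite -ess_supZl//; apply/eq_ess_sup/nearW => x /=.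
by rewrite normrM ger0_norm.
Qed.

Lemma Lnorm_cst_probability d (T : measurableType d) (R : realType)
    (m : probability T R) (p : \bar R) (c : R) :
  (1 <= p)%E -> 0 <= c -> Lnorm m p (fun=> c%:E) = c%:E.
Proof.
move=> p1 c0; have -> : Lnorm m p (fun=> c%:E) = Lnorm m p (fun=> (c * 1)%:E).
  by rewrite mulr1.
rewrite (@ge0_LnormZ _ _ _ m p c (cst 1))//.
have mT : (m : {measure set T -> \bar R}) [set: T] = 1%E by exact: probability_setT.
suff -> : Lnorm m p (EFin \o cst 1) = 1%E by rewrite mule1.
case: p p1 => [s _||//].
  by rewrite (_ : EFin \o cst 1 = cst 1%E)// Lnorm_cst1 mT poweR1r.
move=> _; rewrite unlock /Lnorm mT lte01.
apply: ess_sup_ae_cst; first by rewrite mT.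
by apply: nearW => x /=; rewrite normr1.
Qed.

Lemma measurable_ell_norm d (T : measurableType d) (R : realType) (n : nat)
    (r : \bar R) (g : 'I_n -> T -> R) :
  (forall i, measurable_fun setT (g i)) ->
  measurable_fun setT (fun t => ell_norm r (\row_i g i t)).
Proof.
move=> mg.
have mn i : measurable_fun setT (fun t => `|(\row_i g i t : 'rV[R]_n) ord0 i|).
  under eq_fun do rewrite mxE.
  exact: measurableT_comp.
have mmax : measurable_fun setT
    (fun t => \big[Num.max/0]_i `|(\row_i g i t : 'rV[R]_n) ord0 i|).
  elim: (index_enum 'I_n) => [|i s IH].
    by under eq_fun do rewrite big_nil; exact: measurable_cst.
  by under eq_fun do rewrite big_cons; exact: measurable_maxr.
rewrite /ell_norm; case: r => [s||//] //.
apply: (@measurableT_comp _ _ _ _ _ _ (@powR R ^~ s^-1)) => //.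
apply: measurable_sum => i.
by apply: (@measurableT_comp _ _ _ _ _ _ (@powR R ^~ s)).
Qed.

(** This is the bound n^(1/r) D for the l^r norm of a vector in the cube of
radius D, with the constant moved to the left. Positivity of [n] forces
[D >= 0]. *)
Lemma GW_lower_factor_ell_norm (R : realType) (n : nat) (r : \bar R)
    (x : 'rV[R]_n) (D : R) : (1 <= r)%E -> (0 < n)%N ->
  (forall i, `|x ord0 i| <= D) -> GW_lower_factor n r * ell_norm r x <= D.
Proof.
move=> r1 n0 xD; have D0 : 0 <= D by apply: le_trans (xD (Ordinal n0)).
rewrite /GW_lower_factor /ell_norm; case: r r1 => [s||//]; last first.
  by move=> _; rewrite mul1r; apply: bigmax_le => // i _.
rewrite lee_fin => s1; have s0 : 0 < s by rewrite (lt_le_trans _ s1).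
have nR0 : 0 < n%:R :> R by rewrite ltr0n.
rewrite powRN mulrC ler_pdivrMr ?powR_gt0//.
have -> : D * n%:R `^ s^-1 = (D `^ s * n%:R) `^ s^-1.
  by rewrite powRM ?powR_ge0// -powRrM divff ?gt_eqF// powRr1.
apply: ge0_ler_powR; first by rewrite invr_ge0 ltW.
- by rewrite nnegrE sumr_ge0// => i _; exact: powR_ge0.
- by rewrite nnegrE mulr_ge0// powR_ge0.
rewrite mulr_natr -[X in _ *+ X]card_ord -sumr_const; apply: ler_sum => i _.
by apply: ge0_ler_powR; rewrite ?nnegrE// ltW.
Qed.

Section distances_to.
Context {R : realType} {Z : metricType R} {r : \bar R} (r1 : (1 <= r)%E).
Context {n : nat} (q : 'I_n -> Z).

Lemma mdist_distances_to w w' :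
  mdist (distances_to r1 q w) (distances_to r1 q w') =
  ell_norm r (\row_i (mdist w (q i) - mdist w' (q i))).
Proof.
rewrite [LHS]/(ell_norm r
  (distances_to r1 q w - distances_to r1 q w' : 'rV[R]_n)).
by congr ell_norm; apply/rowP => i; rewrite !mxE.
Qed.

(** The reverse triangle inequality bounds every coordinate by [mdist w w']. *)
Lemma mdist_distances_to_le w w' : (0 < n)%N ->
  GW_lower_factor n r * mdist (distances_to r1 q w) (distances_to r1 q w')
  <= mdist w w'.
Proof.
move=> n0; rewrite mdist_distances_to; apply: GW_lower_factor_ell_norm => // i.
rewrite mxE ler_norml lerBlDr (metric_triangle _ w') andbT lerNl opprB.
by rewrite lerBlDr (metric_sym w) (metric_triangle _ w).
Qed.

(** The path from [w] to [w'] passes through a centre [q i] close to [w]; that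
[w'] is not much farther from [q i] than [w] is recorded by the coordinate [i]
of [distances_to]. *)
Lemma mdist_le_distances_to (h : R) w w' : (exists i, mdist w (q i) <= h) ->
  mdist w w' <= mdist (distances_to r1 q w) (distances_to r1 q w') + 2 * h.
Proof.
move=> [i wi].
have := ell_norm_ge r1 (\row_i (mdist w (q i) - mdist w' (q i))) i.
rewrite -mdist_distances_to mxE ler_norml => /andP[lo _].
have := metric_triangle w (q i) w'; rewrite (metric_sym (q i)).
by lra.
Qed.
End distances_to.

(** [GW] is half the infimum of this quantity over the couplings. *)
Definition distortion {R : realType} {S : metricType R} {p : \bar R}
    (X Y : network S p) (pi : probability (borel X * borel Y)%type R) : \bar R :=
  Lnorm (pi \x pi)%E p (fun z =>
    (mdist (omega X z.1.1 z.2.1) (omega Y z.1.2 z.2.2))%:E).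

Section distortion.
Context {R : realType} {Z : metricType R} {p r : \bar R}.
Variables (p1 : (1 <= p)%E) (r1 : (1 <= r)%E).
Context {n : nat} (q : 'I_n -> Z) (X Y : network Z p).
Variable pi : probability (borel X * borel Y)%type R.
Let XQ := distance_network p1 r1 q X.
Let YQ := distance_network p1 r1 q Y.

(** The l^r distance of the images is an explicit function of finitely many
functions d_Z(omega, q_i), each depending on one network only. *)
Lemma measurable_mdist_distances_to :
  measurable_fun setT (fun z : (borel X * borel Y) * (borel X * borel Y) =>
    mdist (omega XQ z.1.1 z.2.1) (omega YQ z.1.2 z.2.2)).
Proof.
rewrite (_ : (fun _ => _) = fun z : (borel X * borel Y) * (borel X * borel Y) =>
    ell_norm r (\row_i (mdist (omega X z.1.1 z.2.1) (q i) -
                        mdist (omega Y z.1.2 z.2.2) (q i)))); last first.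
  by apply/funext => z; exact: mdist_distances_to.
apply: measurable_ell_norm => i; apply: measurable_funB.
  apply: (@measurableT_comp _ _ _ _ _ _
    (fun u : borel X * borel X => mdist (omega X u.1 u.2) (q i)) _
    (fun z : (borel X * borel Y) * (borel X * borel Y) => (z.1.1, z.2.1))).
    by apply: (measurable_mdist_omega (f := fun s => mdist s (q i))) => e;
      exact: open_mball.
  by apply: measurable_fun_pair; exact: measurableT_comp.
apply: (@measurableT_comp _ _ _ _ _ _
  (fun u : borel Y * borel Y => mdist (omega Y u.1 u.2) (q i)) _
  (fun z : (borel X * borel Y) * (borel X * borel Y) => (z.1.2, z.2.2))).
  by apply: (measurable_mdist_omega (f := fun s => mdist s (q i))) => e;
    exact: open_mball.
by apply: measurable_fun_pair; exact: measurableT_comp.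
Qed.

Lemma distortion_distances_to_le : (0 < n)%N ->
  ((GW_lower_factor n r)%:E * distortion XQ YQ pi
   <= distortion X Y pi)%E.
Proof.
move=> n0; have c0 : 0 <= GW_lower_factor n r :> R.
  by rewrite /GW_lower_factor; case: (r) => // s; exact: powR_ge0.
rewrite [X in (_ * X)%E]/distortion -ge0_LnormZ//; last first.
  exact: measurable_mdist_distances_to.
apply: ge0_le_Lnorm => // z.
by rewrite mulr_ge0 ?mdist_ge0//=; exact: mdist_distances_to_le.
Qed.

Lemma distortion_le_distances_to (h : R) : 0 <= h ->
  (forall w, exists i, mdist w (q i) <= h) ->
  (distortion X Y pi <= distortion XQ YQ pi + (2 * h)%:E)%E.
Proof.
move=> h0 netq; have h20 : 0 <= 2 * h by rewrite mulr_ge0.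
rewrite -(@Lnorm_cst_probability _ _ _ (pi \x pi)%E p (2 * h))//.
apply: le_trans (eminkowski (pi \x pi)%E measurable_mdist_distances_to
  (measurable_cst (2 * h)) p1).
apply: ge0_le_Lnorm => // z.
by rewrite mdist_ge0/=; apply: mdist_le_distances_to.
Qed.

End distortion.

(** The infimum over the centres need not be known to be attained: a strict
upper bound on it already provides a centre. *)
Lemma hausdorff_distance_range_lt (R : realType) (Z : metricType R) (n : nat)
    (q : 'I_n -> Z) (h : R) (w : Z) :
  (hausdorff_distance [set: Z] (range q) < h%:E)%E ->
  exists i, mdist w (q i) <= h.
Proof.
rewrite /hausdorff_distance gt_max => /andP[Hh _].
have : (ereal_inf [set (mdist w b)%:E | b in range q] < h%:E)%E.
  by apply: le_lt_trans Hh; apply: ereal_sup_ubound; exists w.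
move=> /ereal_inf_lt[_ [_ [i _ <-] <-]]; rewrite lte_fin => /ltW wi.
by exists i.
Qed.

(** The supremum over the points of Z could be -oo if Z were empty; the first
centre rules this out. *)
Lemma hausdorff_distance_range_ge0 (R : realType) (Z : metricType R) (n : nat)
    (q : 'I_n -> Z) : (0 < n)%N ->
  (0 <= hausdorff_distance [set: Z] (range q))%E.
Proof.
move=> n0; rewrite /hausdorff_distance le_max; apply/orP; left.
apply: (@le_trans _ _
    (ereal_inf [set (mdist (q (Ordinal n0)) b)%:E | b in range q])).
  by apply: le_ereal_inf_tmp => _ [b _ <-]; rewrite lee_fin mdist_ge0.
by apply: ereal_sup_ubound; exists (q (Ordinal n0)).
Qed.

Theorem theorem51 (R : realType) (Z : metricType R)
    (Zcomplete : cauchy_complete (@mdist R Z)) (Zseparable : separable Z)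
    (Zbounded : bounded_distance (@mdist R Z))
    (p r : \bar R) (p1 : (1 <= p)%E) (r1 : (1 <= r)%E)
    (X Y : network Z p) (n : nat) (n0 : (0 < n)%N) (q : 'I_n -> Z) :
  ((GW_lower_factor n r)%:E *
     GW (distance_network p1 r1 q X) (distance_network p1 r1 q Y)
   <= GW X Y)%E /\
  (GW X Y
   <= GW (distance_network p1 r1 q X) (distance_network p1 r1 q Y) +
      hausdorff_distance [set: Z] (range q))%E.
Proof.
set XQ := distance_network p1 r1 q X; set YQ := distance_network p1 r1 q Y.
pose coup := coupling (mu X) (mu Y).
have GWE : GW X Y = (2^-1%:E * ereal_inf [set distortion X Y pi | pi in coup])%E.
  by [].
have GWQE : GW XQ YQ =
    (2^-1%:E * ereal_inf [set distortion XQ YQ pi | pi in coup])%E by [].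
have infQ0 : (0 <= ereal_inf [set distortion XQ YQ pi | pi in coup])%E.
  by apply: le_ereal_inf_tmp => _ [pi _ <-]; exact: Lnorm_ge0.
rewrite GWE GWQE; split.
  rewrite muleCA; apply: lee_wpmul2l; first by rewrite lee_fin invr_ge0.
  apply: le_ereal_inf_tmp => _ [pi cpi <-].
  apply: le_trans (distortion_distances_to_le p1 r1 q X Y pi n0).
  apply: lee_wpmul2l.
    by rewrite lee_fin /GW_lower_factor; case: (r) => // s; exact: powR_ge0.
  by apply: ereal_inf_lbound; exists pi.
have H0 := hausdorff_distance_range_ge0 _ _ _ q n0.
have [->|Hy] := eqVneq (hausdorff_distance [set: Z] (range q)) +oo%E.
  rewrite addey ?leey// gt_eqF// (@lt_le_trans _ _ 0%E)//.
  by rewrite mule_ge0// lee_fin invr_ge0.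
have Hfin : hausdorff_distance [set: Z] (range q) \is a fin_num.
  by rewrite ge0_fin_numE// ltey.
(* The slack [e] makes [h] a strict bound on the Hausdorff distance, so that
   every point of Z has a centre within [h]. *)
apply/lee_addgt0Pr => e e0.
rewrite -(fineK Hfin) -addeA -EFinD; set h := fine _ + e.
have h0 : 0 <= h by rewrite addr_ge0 ?fine_ge0// ltW.
have netq w : exists i, mdist w (q i) <= h.
  apply: hausdorff_distance_range_lt.
  by rewrite -(fineK Hfin) lte_fin ltrDl.
have -> : h%:E = (2^-1%:E * (2 * h)%:E)%E.
  by rewrite -EFinM mulrA mulVf ?mul1r// pnatr_eq0.
rewrite -muleDr ?fin_num_adde_defl//.
apply: lee_wpmul2l; first by rewrite lee_fin invr_ge0.
rewrite -leeBlDr//; apply: le_ereal_inf_tmp => _ [pi cpi <-].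
rewrite leeBlDr//.
apply: le_trans (distortion_le_distances_to p1 r1 q X Y pi h h0 netq).
by apply: ereal_inf_lbound; exists pi.
Qed.
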